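(* The double well potential function $g$ on $\mathbb{R}^n$ has at most one local maximizer.
   Context: Let $n\ge 1$ be an integer, $\nu\in\mathbb{R}$, $\psi=(\psi_1,\dots,\psi_n)^T\in\mathbb{R}^n$, and $D=\mathrm{Diag}(\alpha_1,\dots,\alpha_n)$ a real diagonal matrix with $\alpha_1\le\alpha_2\le\dots\le\alpha_n$. The double well potential function is $g:\mathbb{R}^n\to\mathbb{R}$, $$g(w)=\frac12\left(\frac12\|w\|^2-\nu\right)^2+\frac12 w^TDw-\psi^Tw,$$ where $\|\cdot\|$ is the Euclidean norm. *)

(* Defs.v *)
From mathcomp Require Import all_boot all_order all_algebra.
From mathcomp Require Import all_classical all_reals all_analysis.
Import Order.TTheory GRing.Theory Num.Theory.
Import numFieldNormedType.Exports.
Set Implicit Arguments.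
Unset Strict Implicit.
Unset Printing Implicit Defensive.
Local Open Scope classical_set_scope.
Local Open Scope ring_scope.

(* The library norm `|w| on 'cV[R]_n is the sup norm, so the Euclidean norm is
   defined separately; the topology is the same. *)
Definition enorm (R : realType) (n : nat) (w : 'cV[R]_n) : R :=
  Num.sqrt (\sum_(i < n) w i 0 ^+ 2).

Definition double_well (R : realType) (n : nat) (nu : R) (psi : 'cV[R]_n)
    (alpha : 'rV[R]_n) (w : 'cV[R]_n) : R :=
  2^-1 * (2^-1 * enorm w ^+ 2 - nu) ^+ 2
  + 2^-1 * (w^T *m diag_mx alpha *m w) 0 0
  - (psi^T *m w) 0 0.

Definition local_maximizer (R : realType) (T : topologicalType) (f : T -> R)
    (x : T) : Prop :=
  \forall y \near x, f y <= f x.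

(* Main.v *)
(** Restricted to the line through two distinct local maximizers, the potential
    is a quartic polynomial with positive leading coefficient. Its derivative
    is a cubic with positive leading coefficient, which cannot vanish at 0 and
    at 1 while being nonincreasing at both points. *)
Require Import Defs.
From mathcomp Require Import all_boot all_order all_algebra ring lra.
From mathcomp Require Import all_classical all_reals all_analysis.
Import Order.TTheory GRing.Theory Num.Theory.
Import numFieldNormedType.Exports.
Local Open Scope classical_set_scope.
Local Open Scope ring_scope.

(** Serves the divisions by powers of [t] below: they give a sign for [t > 0] only, and continuity
    of [p] carries it to [0]. *)
Lemma horner_near_le0 (R : realType) (p : {poly R}) :
  (\forall t \near 0^'+, p.[t] <= 0) -> p.[0] <= 0.
Proof.
move=> ple0; apply: (cvgr_to_le _ ple0).
by apply: cvg_at_right_filter; exact: continuous_horner.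
Qed.

Lemma near0_oppr (R : realType) (P : R -> Prop) :
  (\forall t \near (0 : R), P t) -> \forall t \near (0 : R), P (- t).
Proof.
move=> nP; have /(_ P) := @oppr_continuous R R^o 0.
by rewrite oppr0; apply.
Qed.

(** Dividing by [t > 0] leaves a cubic that is nonpositive to the right of [0] and has value [a] at
    [0]. *)
Lemma quartic_near_le0_linear (R : realType) (a b c d : R) :
  (\forall t \near (0 : R),
    a * t + b * t ^+ 2 + c * t ^+ 3 + d * t ^+ 4 <= 0) ->
  a <= 0.
Proof.
move=> le0; suff : (a%:P + b *: 'X + c *: 'X^2 + d *: 'X^3).[0] <= 0.
  by rewrite !hornerE /= !mulr0 !addr0.
apply: horner_near_le0; near=> t.
have t0 : 0 < t by near: t; exact: nbhs_right_gt.
rewrite -(pmulr_rle0 _ t0).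
have -> : t * (a%:P + b *: 'X + c *: 'X^2 + d *: 'X^3).[t] =
    a * t + b * t ^+ 2 + c * t ^+ 3 + d * t ^+ 4 by rewrite !hornerE /=; ring.
by near: t; exact: cvg_within.
Unshelve. all: by end_near. Qed.

Lemma quartic_near_le0 (R : realType) (a b c d : R) :
  (\forall t \near (0 : R),
    a * t + b * t ^+ 2 + c * t ^+ 3 + d * t ^+ 4 <= 0) ->
  a = 0 /\ b <= 0.
Proof.
move=> le0; have a0 : a = 0.
  apply: le_anti; rewrite (quartic_near_le0_linear _ _ _ _ _ le0) /=.
  (* The substitution [t -> - t] flips the signs of the odd coefficients [a] and [c]. *)
  rewrite -oppr_le0; apply: (@quartic_near_le0_linear _ _ b (- c) d).
  apply: filterS (near0_oppr _ _ le0) => t; congr (_ <= _); ring.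
split=> //; suff : (b%:P + c *: 'X + d *: 'X^2).[0] <= 0.
  by rewrite !hornerE /= !mulr0 !addr0.
(* Since [a = 0], the quartic can now be divided by [t ^+ 2], and [b] is the value of the quotient
   at [0]. *)
apply: horner_near_le0; near=> t.
have t0 : 0 < t by near: t; exact: nbhs_right_gt.
rewrite -(pmulr_rle0 _ (exprn_gt0 2 t0)).
have -> : t ^+ 2 * (b%:P + c *: 'X + d *: 'X^2).[t] =
    a * t + b * t ^+ 2 + c * t ^+ 3 + d * t ^+ 4.
  by rewrite a0 !hornerE /=; ring.
by near: t; exact: cvg_within.
Unshelve. all: by end_near. Qed.

Lemma enorm_sqr (R : realType) (n : nat) (w : 'cV[R]_n) :
  enorm w ^+ 2 = \sum_(i < n) w i 0 ^+ 2.
Proof. by rewrite sqr_sqrtr// sumr_ge0// => i _; rewrite sqr_ge0. Qed.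

Lemma enorm_gt0 (R : realType) (n : nat) (w : 'cV[R]_n) :
  w != 0 -> 0 < enorm w.
Proof.
move=> w0; rewrite lt_neqAle sqrtr_ge0 andbT eq_sym.
apply: contra w0 => /eqP e0.
have := enorm_sqr _ _ w; rewrite e0 expr0n /= => /esym/psumr_eq0P s0.
apply/eqP/matrixP => i j; rewrite ord1 mxE.
by apply/eqP; rewrite -sqrf_eq0 s0// => k _; rewrite sqr_ge0.
Qed.

Lemma enorm_sqr_line (R : realType) (n : nat) (x d : 'cV[R]_n) (t : R) :
  enorm (x + t *: d) ^+ 2 =
  enorm x ^+ 2 + (x^T *m d) 0 0 * 2 * t + enorm d ^+ 2 * t ^+ 2.
Proof.
rewrite !enorm_sqr mxE !mulr_suml -!big_split /=.
by apply: eq_bigr => i _; rewrite !mxE; ring.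
Qed.

Lemma quadratic_form_line (R : realType) (n : nat) (A : 'M[R]_n)
    (x d : 'cV[R]_n) (t : R) :
  ((x + t *: d)^T *m A *m (x + t *: d)) 0 0 =
  (x^T *m A *m x) 0 0 + ((x^T *m A *m d) 0 0 + (d^T *m A *m x) 0 0) * t
  + (d^T *m A *m d) 0 0 * t ^+ 2.
Proof.
rewrite [(x + _)^T]linearD /= [(t *: d)^T]linearZ /= !mulmxDl !mulmxDr.
rewrite -!scalemxAl -!scalemxAr.
(* Generalizing the products keeps [mxE] from expanding them into sums. *)
move: (x^T *m A *m x) (x^T *m A *m d) (d^T *m A *m x) (d^T *m A *m d).
by move=> p q r s; rewrite !mxE; ring.
Qed.

(** Degree 4 comes only from the squared term: half the square of [enorm d ^+ 2 / 2 * t ^+ 2]. *)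
Lemma double_well_line (R : realType) (n : nat) (nu : R) (psi : 'cV[R]_n)
    (alpha : 'rV[R]_n) (x d : 'cV[R]_n) :
  exists a b c : R, forall t : R,
    double_well nu psi alpha (x + t *: d) =
    double_well nu psi alpha x + a * t + b * t ^+ 2 + c * t ^+ 3
    + enorm d ^+ 4 / 8 * t ^+ 4.
Proof.
pose s := 2^-1 * enorm x ^+ 2 - nu; pose B := (x^T *m d) 0 0.
pose A := diag_mx alpha.
(* Along the line the bracket of the potential is [s + B * t + enorm d ^+ 2 / 2 * t ^+ 2]; half its
   square is expanded, and the quadratic and linear terms are added. *)
exists (s * B + 2^-1 * ((x^T *m A *m d) 0 0 + (d^T *m A *m x) 0 0)
        - (psi^T *m d) 0 0),
  (2^-1 * B ^+ 2 + 2^-1 * s * enorm d ^+ 2 + 2^-1 * (d^T *m A *m d) 0 0),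
  (2^-1 * B * enorm d ^+ 2) => t.
rewrite /double_well enorm_sqr_line quadratic_form_line mulmxDr -scalemxAr.
rewrite /B /s /A; move: (psi^T *m x) (psi^T *m d) => p q.
by rewrite [(p + _) _ _]mxE [(t *: q) _ _]mxE; field.
Qed.

Lemma local_maximizer_line (R : realType) (n : nat) (f : 'cV[R]_n -> R)
    (x d : 'cV[R]_n) :
  local_maximizer f x -> \forall t \near (0 : R), f (x + t *: d) <= f x.
Proof.
move=> fx.
have : (fun t : R => x + t *: d) @ 0 --> x.
  rewrite -[X in _ --> X]addr0 -[X in _ + X](scale0r d).
  by apply: cvgD; [exact: cvg_cst|apply: cvgZr_tmp; exact: cvg_id].
by move=> /(_ _ fx).
Qed.

Theorem theorem4 (R : realType) (n : nat) (hn : (1 <= n)%N) (nu : R)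
  (psi : 'cV[R]_n) (alpha : 'rV[R]_n)
  (halpha : forall i j : 'I_n, (i <= j)%N -> alpha 0 i <= alpha 0 j)
  (x y : 'cV[R]_n)
  (hx : local_maximizer (double_well nu psi alpha) x)
  (hy : local_maximizer (double_well nu psi alpha) y) :
  x = y.
Proof.
apply/eqP; rewrite eq_sym -subr_eq0; apply/negPn/negP => /enorm_gt0 d_gt0.
set d := y - x in d_gt0.
have [a [b [c gE]]] := double_well_line _ _ nu psi alpha x d.
set e := enorm d ^+ 4 / 8 in gE.
have e_gt0 : 0 < e by rewrite divr_gt0// exprn_gt0.
have [a0 b_le0] : a = 0 /\ b <= 0.
  apply: (@quartic_near_le0 _ a b c e).
  by apply: filterS (local_maximizer_line _ _ _ _ d hx) => t; rewrite gE; lra.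
(* Taylor coefficients at [1] of the quartic along the line: its first derivative and half its
   second, with [c + 4 * e] in degree 3. *)
have [deriv1_eq0 deriv2_le0] :
    a + 2 * b + 3 * c + 4 * e = 0 /\ b + 3 * c + 6 * e <= 0.
  apply: (@quartic_near_le0 _ _ _ (c + 4 * e) e).
  apply: filterS (local_maximizer_line _ _ _ _ d hy) => t.
  have -> : y + t *: d = x + (1 + t) *: d.
    by rewrite scalerDl scale1r addrA /d subrKC.
  have -> : y = x + 1 *: d by rewrite scale1r /d subrKC.
  rewrite !gE -subr_le0; congr (_ <= _); ring.
(* With [a = 0], subtracting [deriv1_eq0] from [deriv2_le0] gives [2 * e <= b], against
   [b <= 0 < e]. *)
lra.
Qed.
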